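(* Let $(\widetilde M,\tilde o)$ be a surface of revolution with $\ell=\infty$ and radial curvature function $K:[0,\infty)\to\mathbb R$. Let $(M,o)$ be a noncompact pointed Alexandrov space with base point $o$ and with radial curvature bounded below by the function $K$. If the total curvature of $\widetilde M$ is positive, then $M$ has one end and has no straight line.
   Context: Surface of revolution: $(\widetilde M,\tilde o)$ is a complete surface with geodesic polar coordinates $(r,\theta)$ around $\tilde o$ in which $ds^2=dr^2+f(r)^2d\theta^2$, where (for $\ell=\infty$) $f(r)>0$ for $0<r<\infty$, $\theta\in S^1$, $f''+Kf=0$, $f(0)=0$, $f'(0)=1$. $K$ is the radial curvature function. The total curvature is the integral of the Gauss curvature over $\widetilde M$. A straight line is a complete geodesic $\mathbb R\to M$ each of whose subarcs is minimizing. $T(x,y)$ denotes a minimizing geodesic segment joining $x,y$, with unit speed parametrization $T(x,y)(t)$, $0\le t\le d(x,y)$, from $x$ to $y$. A geodesic triangle $\triangle opq$ is a triple of minimizing segments $T(o,p)\cup T(o,q)\cup T(p,q)$. A geodesic triangle $\triangle\tilde o\tilde p\tilde q$ in $\widetilde M$ is a comparison triangle of $\triangle opq$ if corresponding edges have equal lengths. For $p\in M$ let $\tilde p=(r,\theta)=(d(o,p),0)$. For $\tilde x\in\widetilde M$ put $\widetilde M^+_{\tilde x}=\{\theta(\tilde x)\le\theta\le\theta(\tilde x)+\pi\}$, $\widetilde M^-_{\tilde x}=\{\theta(\tilde x)-\pi\le\theta\le\theta(\tilde x)\}$ (both containing $\tilde o$). Put $F_p(x)=(d(o,x),d(p,x))$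 for $x\in M$, $\widetilde F_{\tilde p}(\tilde x)=(d(\tilde o,\tilde x),d(\tilde p,\tilde x))$ on $\widetilde M^+_{\tilde p}$, $\widetilde G_{\tilde p}(\tilde x)=(d(\tilde o,\tilde x),d(\tilde p,\tilde x))$ on $\widetilde M^-_{\tilde p}$; $\widetilde F_{\tilde p},\widetilde G_{\tilde p}$ are injective for $\tilde p\ne\tilde o$. The reference point of $q\in M$ is $\tilde q=\widetilde F_{\tilde p}^{-1}(F_p(q))$. The reference curve and reference reverse curve of $T(p,q)$ are $$\widetilde T(p,q)(t)=\widetilde F_{\tilde p}^{-1}\circ F_p(T(p,q)(t)),\qquad \widetilde R(p,q)(t)=\widetilde G_{\tilde q}^{-1}\circ F_q(T(p,q)(d(p,q)-t)),\quad 0\le t\le d(p,q).$$ For sets $C_1,C_2\subset\widetilde M$ meeting each meridian $[\theta=a]$ in at most one point, $C_1\le C_2$ means $r(C_1\cap[\theta=a])\le r(C_2\cap[\theta=a])$ for all $a$ for which both intersections are nonempty. Pointed Alexandrov space with radial curvature bounded below by $K$: an Alexandrov space $(M,o)$ with curvature locally bounded below such that (1) every geodesic triangle $\triangle opq$ in $M$ admits a comparison triangle $\triangle\tilde o\tilde p\tilde q$ in $\widetilde M$ satisfying $$( * )\qquad \widetilde T(p,q)\ge T(\tilde p,\tilde q)\quad\text{and}\quad\widetilde R(p,q)\ge T(\tilde p,\tilde q);$$ (2) conversely, for every geodesic triangle $\triangle\tilde o\tilde p\tilde q$ in $\widetilde M$ whose vertices $\tilde p,\tilde q$ are the reference points of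 points $p,q\in M$, there exists a geodesic triangle $\triangle opq$ in $M$ satisfying $( * )$. (Here $p,q\neq o$, so that the reference curves are defined.) *)

(* Defs.v *)
(* MathComp-Analysis, over an arbitrary [R : realType]. *)
From HB Require Import structures.
From mathcomp Require Import all_boot all_order all_algebra.
From mathcomp Require Import all_classical all_reals all_analysis.

Set Implicit Arguments.
Unset Strict Implicit.
Unset Printing Implicit Defensive.

Import Order.TTheory GRing.Theory Num.Theory.
Import numFieldTopology.Exports numFieldNormedType.Exports.

Local Open Scope classical_set_scope.
Local Open Scope ring_scope.

Section Segments.
Context {R : realType} {X : Type}.
Variable d : X -> X -> R.

(* [T] is a minimizing segment from [x] to [y], parametrized by arc length;
   only its values on [0, d x y] matter. *)
Definition segment (x y : X) (T : R -> X) : Prop :=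
  [/\ T 0 = x, T (d x y) = y &
      forall s t, 0 <= s <= d x y -> 0 <= t <= d x y ->
        d (T s) (T t) = `|s - t|].

Definition triangle (o p q : X) (Top Toq Tpq : R -> X) : Prop :=
  [/\ segment o p Top, segment o q Toq & segment p q Tpq].

Definition straight_line (g : R -> X) : Prop :=
  forall s t, d (g s) (g t) = `|s - t|.

End Segments.

(* The surface of revolution with l = +oo.  Its underlying manifold is R^2,
   described by Cartesian coordinates (r cos theta, r sin theta), so that the
   base point is the origin; the metric is dr^2 + f(r)^2 dtheta^2. *)
Section SurfaceOfRevolution.
Context {R : realType}.
Implicit Types (K f : R -> R) (x y z w : R * R).

(* Only the values of [f] and [K] on [0, +oo[ matter; the third clause is
   f'(0) = 1, as a one-sided derivative.  Completeness of the surface needs no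
   clause: it follows from l = +oo. *)
Record surface_of_revolution K f : Prop := SurfaceOfRevolution {
  sor_curvature_continuous : {within `[0, +oo[, continuous K};
  sor_f0 : f 0 = 0;
  sor_df0 : (f h / h) @[h --> 0^'+] --> (1 : R);
  sor_f_gt0 : forall r : R, 0 < r -> 0 < f r;
  sor_f_derivable : forall r : R, 0 < r -> derivable f r 1;
  sor_df_derivable : forall r : R, 0 < r -> derivable (derive1 f) r 1;
  sor_jacobi : forall r : R, 0 < r -> derive1 (derive1 f) r + K r * f r = 0
}.

Definition origin : R * R := (0, 0).

Definition rad x : R := Num.sqrt (x.1 ^+ 2 + x.2 ^+ 2).

Definition polar (r a : R) : R * R := (r * cos a, r * sin a).

(* Riemannian norm of the tangent vector [w] at [z]: if r = rad z <> 0 then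
   dr(w) = (z.1 w.1 + z.2 w.2) / r, dtheta(w) = (z.1 w.2 - z.2 w.1) / r^2;
   at the origin the metric is Euclidean because f'(0) = 1. *)
Definition riem_norm f z w : R :=
  if rad z == 0 then rad w
  else Num.sqrt (((z.1 * w.1 + z.2 * w.2) / rad z) ^+ 2 +
         (f (rad z) * ((z.1 * w.2 - z.2 * w.1) / rad z ^+ 2)) ^+ 2).

Definition C1 (g : R -> R) : Prop :=
  (forall t, derivable g t 1) /\ continuous (derive1 g).

(* A C^1 arc on [0, 1], given by a C^1 extension to R. *)
Definition C1_arc (g : R -> R * R) : Prop := C1 (fst \o g) /\ C1 (snd \o g).

Definition arc_length f (g : R -> R * R) : R :=
  \int[lebesgue_measure]_(t in `[0, 1])
    riem_norm f (g t) (derive1 (fst \o g) t, derive1 (snd \o g) t).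

(* [broken_arc f x y L]: a piecewise C^1 curve from [x] to [y] has length [L] *)
Inductive broken_arc f : R * R -> R * R -> R -> Prop :=
| broken_nil x : broken_arc f x x 0
| broken_cons g y L : C1_arc g -> broken_arc f (g 1) y L ->
    broken_arc f (g 0) y (arc_length f g + L).

Definition sdist f x y : R := inf [set L | broken_arc f x y L].

(* The integral of K against the area element f dr dtheta.  When both the
   positive and the negative part have infinite integral (no total curvature),
   the value is +oo - oo = -oo, which is not positive. *)
Definition total_curvature K f : \bar R :=
  \int[(lebesgue_measure \x lebesgue_measure)%E]_(z in
      `[0, +oo[ `*` `[0, 2 * pi]) (K z.1 * f z.1)%:E.

(* theta(x) <= theta(y) <= theta(x) + pi, resp.
   theta(x) - pi <= theta(y) <= theta(x), for x different from the origin;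
   the origin has every angle, hence lies in both half surfaces. *)
Definition half_plus x : set (R * R) :=
  [set y | exists a b, [/\ x = polar (rad x) a, y = polar (rad y) b &
                           a <= b <= a + pi]].

Definition half_minus x : set (R * R) :=
  [set y | exists a b, [/\ x = polar (rad x) a, y = polar (rad y) b &
                           a - pi <= b <= a]].

Definition meridian_trace (C : set (R * R)) (a : R) : set R :=
  [set r | 0 <= r /\ C (polar r a)].

(* C1 <= C2.  When C1 and C2 meet the meridian theta = a in one point each, the
   two clauses both say that r(C1 cap [theta = a]) <= r(C2 cap [theta = a]).
   They also give a meaning to degenerate triangles, whose edges lie along
   meridians and meet them in segments: these are compared by their two ends. *)
Definition curve_le (A B : set (R * R)) : Prop :=
  forall a, meridian_trace A a !=set0 -> meridian_trace B a !=set0 ->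
    (forall r, meridian_trace A a r ->
       exists2 s, meridian_trace B a s & r <= s) /\
    (forall s, meridian_trace B a s ->
       exists2 r, meridian_trace A a r & r <= s).

End SurfaceOfRevolution.

Section AlexandrovSpaces.
Context {R : realType} (M : metricType R).

Definition complete_space : Prop :=
  forall F : set_system M, ProperFilter F -> cauchy F -> exists x : M, F --> x.

Definition path_length (c : R -> M) : \bar R :=
  ereal_sup [set L | exists (n : nat) (t : nat -> R),
    [/\ forall i, 0 <= t i <= 1, forall i, t i <= t i.+1 &
        L = (\sum_(i < n) mdist (c (t i)) (c (t i.+1)))%:E]].

Definition length_space : Prop :=
  forall x y : M, (mdist x y)%:E = ereal_inf [set L | exists c : R -> M,
    [/\ {within `[0, 1], continuous c}, c 0 = x, c 1 = y & L = path_length c]].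

(* The hyperbolic plane of curvature - k^2 is the surface of revolution with
   f(r) = sinh(k r) / k. *)
Definition hyp_profile (k r : R) : R := (expR (k * r) - expR (- (k * r))) / (2 * k).

(* Distance comparison on [U] with the plane of curvature - k^2: [y] is the
   vertex opposite to the side [T], and [yt xt zt] is a comparison triangle, in
   which [st] corresponds to the point [T s]. *)
Definition curvature_ge_on (k : R) (U : set M) : Prop :=
  forall (x y z : M) (T : R -> M) (s : R) (xt yt zt st : R * R),
    let d := sdist (hyp_profile k) in
    U x -> U y -> U z -> segment mdist x z T -> 0 <= s <= mdist x z ->
    d xt yt = mdist x y -> d yt zt = mdist y z -> d xt zt = mdist x z ->
    d xt st = s -> d st zt = mdist x z - s ->
    d yt st <= mdist y (T s).

(* A lower curvature bound may always be lowered, so the local bounds can be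
   taken of the form - k^2 with k > 0. *)
Record alexandrov_space : Prop := AlexandrovSpace {
  alex_complete : complete_space;
  alex_locally_compact : locally_compact [set: M];
  alex_length : length_space;
  alex_curvature : forall x : M, exists2 k : R, 0 < k &
    exists2 U : set M, nbhs x U & curvature_ge_on k U
}.

(* Ends: compatible choices of a connected component of the complement of every
   compact set, i.e. points of the inverse limit of the sets of components. *)
Definition is_end (e : set M -> set M) : Prop :=
  (forall C : set M, compact C ->
     exists2 x, (~` C) x & e C = connected_component (~` C) x) /\
  (forall C D : set M, compact C -> compact D -> C `<=` D -> e D `<=` e C).

Definition has_one_end : Prop :=
  exists2 e, is_end e &
    forall e', is_end e' -> forall C : set M, compact C -> e' C = e C.

End AlexandrovSpaces.

Section RadialCurvature.
Context {R : realType} (f : R -> R) {M : metricType R} (o : M).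
Implicit Types (p q x : M) (xt pt qt : R * R).

Local Notation d := (@mdist R M).
Local Notation dt := (sdist f).

Definition base_reference p : R * R := polar (d o p) 0.

(* xt = tilde F_{pt}^{-1} (F_p x), resp. xt = tilde G_{pt}^{-1} (F_p x) *)
Definition F_reference p pt x xt : Prop :=
  half_plus pt xt /\ (dt origin xt, dt pt xt) = (d o x, d p x).

Definition G_reference p pt x xt : Prop :=
  half_minus pt xt /\ (dt origin xt, dt pt xt) = (d o x, d p x).

Definition reference_curve p q pt (T : R -> M) (c : R -> R * R) : Prop :=
  forall t, 0 <= t <= d p q -> F_reference p pt (T t) (c t).

Definition reference_reverse_curve p q qt (T : R -> M) (c : R -> R * R) : Prop :=
  forall t, 0 <= t <= d p q -> G_reference q qt (T (d p q - t)) (c t).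

(* The condition ( * ): the existence of the curves is the claim that they are
   defined; they are unique on [0, d p q], F and G being injective. *)
Definition toponogov p q pt qt (T : R -> M) (Tt : R -> R * R) : Prop :=
  exists c cr : R -> R * R,
    [/\ reference_curve p q pt T c,
        reference_reverse_curve p q qt T cr,
        curve_le (Tt @` `[0, dt pt qt]) (c @` `[0, d p q]) &
        curve_le (Tt @` `[0, dt pt qt]) (cr @` `[0, d p q])].

Definition comparison_triangle p q pt qt : Prop :=
  [/\ dt origin pt = d o p, dt origin qt = d o q & dt pt qt = d p q].

Record radial_curvature_bounded_below : Prop := RadialCurvatureBoundedBelow {
  rcb_alexandrov : alexandrov_space M;
  rcb_comparison : forall p q (Top Toq Tpq : R -> M), p <> o -> q <> o ->
    triangle d o p q Top Toq Tpq ->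
    let pt := base_reference p in
    exists qt (Topt Toqt Tpqt : R -> R * R),
      [/\ F_reference p pt q qt,
          triangle dt origin pt qt Topt Toqt Tpqt,
          comparison_triangle p q pt qt &
          toponogov p q pt qt Tpq Tpqt];
  rcb_converse : forall p q qt (Topt Toqt Tpqt : R -> R * R),
    p <> o -> q <> o ->
    let pt := base_reference p in
    F_reference p pt q qt ->
    triangle dt origin pt qt Topt Toqt Tpqt ->
    exists Top Toq Tpq : R -> M,
      triangle d o p q Top Toq Tpq /\ toponogov p q pt qt Tpq Tpqt
}.

End RadialCurvature.

(* Main.v *)
Require Import Defs.
From HB Require Import structures.
From mathcomp Require Import all_boot all_order all_algebra.
From mathcomp Require Import all_classical all_reals all_analysis.
From mathcomp Require Import measurable_realfun ring lra.

Set Implicit Arguments.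
Unset Strict Implicit.
Unset Printing Implicit Defensive.

Import Order.TTheory GRing.Theory Num.Theory.
Import numFieldTopology.Exports numFieldNormedType.Exports.

Local Open Scope classical_set_scope.
Local Open Scope ring_scope.

(** Positive total curvature makes the surface of revolution thin at infinity.
Since the total curvature is 2 pi times the limit of the integral of K f, and f''
= - K f with f'(0) = 1, the slope f' eventually stays below some number smaller
than 1, whence f(r) <= k r for all large r, with k < 1 ([profile_growth]).  So
far from the origin the metric is dominated by that of a cone of total angle 2 pi
k < 2 pi.  In the flat development of this cone two points at the same distance r
from the apex, at angle at most pi, are seen under an angle at most k pi < pi;
the straight chord between them has length at most 2 r sin (k pi / 2), and stays
at distance at least r cos (k pi / 2) from the apex.  Replacing, on the path
through the origin, the part inside a large circle by such a chord saves any
prescribed length 2 rho ([broken_arc_chord], [sdist_detour]).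

The existence of a comparison triangle carries this inequality over to M: the
polar radius on the surface is the distance to the origin ([sdist_origin]), so
any two points p and q far from o satisfy d(p, q) < d(o, p) + d(o, q) - 2 rho
([radial_bound_short_chords]).  By the triangle inequality a minimizing segment
from p to q then avoids the closed ball of radius rho around o.  Both conclusions
follow.  The segments between far points stay away from any given compact set,
so its complement has only one component that reaches infinity ([one_end]).  A
straight line through a point at distance rho from o would contain minimizing
segments between arbitrarily far points that meet this ball
([no_straight_line]).

Triangles and compact balls in M are provided by the theorem of Hopf, Rinow and
Cohn-Vossen for complete locally compact length spaces ([compact_mball],
[segment_exists]).  It rests on one construction, [approx_segment]: on a curve
from x to y that is almost as short as possible, the points at distance s from
x, for s in [0, d x y], form a curve that is an isometry up to a small error.
The limit of these curves along an ultrafilter is a minimizing segment. *)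

(** * Complete locally compact length spaces *)

Section MetricGeometry.
Context {R : realType} (M : metricType R).
Implicit Types (x y z p q o : M) (r s t e : R).
Local Notation d := (@mdist R M).

Let mball x r : set M := [set y | d x y <= r].

Lemma ler_mdistB x y z : `|d x y - d x z| <= d y z.
Proof.
have h1 := metric_triangle x y z; have h2 := metric_triangle x z y.
by rewrite (metric_sym z y) in h2; rewrite ler_norml; apply/andP; split; lra.
Qed.

Lemma mdist_continuous x : continuous (d x).
Proof.
move=> y; apply/cvgrPdist_lt => e e0.
have : nbhs y (ball y e) by exact: nbhsx_ballx.
apply: filterS => z; rewrite ballEmdist/= => yz.
exact: le_lt_trans (ler_mdistB _ _ _) yz.
Qed.

Lemma mball_closed x r : closed (mball x r).
Proof.
have -> : mball x r = d x @^-1` [set t | t <= r] by [].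
apply: preimage_closed; last exact: closed_le.
by move=> y _; exact: mdist_continuous.
Qed.

(** The curve [T] selects on an almost shortest path [c] a point at each distance
[s] from [x], by the intermediate value theorem.  Two such points cannot be
much farther apart than [|s - t|], because the remaining two pieces of [c] use
up at least [s] and [d x y - t] of its length. *)
Lemma approx_segment x y e : length_space M -> 0 < e ->
  exists T : R -> M, [/\
    forall s, 0 <= s <= d x y -> d x (T s) = s,
    forall s, 0 <= s <= d x y -> d (T s) y <= d x y - s + e &
    forall s t, 0 <= s <= d x y -> 0 <= t <= d x y ->
      d (T s) (T t) <= `|s - t| + e].
Proof.
move=> /(_ x y) hl e0.
set D := d x y in hl *.
have : (D%:E < (D + e)%:E)%E by rewrite lte_fin ltrDl.
rewrite {1}hl => /ereal_inf_lt[_ [c [cc c0 c1 ->]] Lc].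
have sumE n (u : nat -> R) : (forall i, 0 <= u i <= 1) ->
    (forall i, u i <= u i.+1) ->
    \sum_(i < n) d (c (u i)) (c (u i.+1)) < D + e.
  move=> u01 uS; rewrite -lte_fin; apply: le_lt_trans Lc.
  by apply: ereal_sup_ubound; exists n, u.
(* the subdivision 0, a, b, 1 of [c] *)
have sum3 a b : 0 <= a -> a <= b -> b <= 1 ->
    d x (c a) + d (c a) (c b) + d (c b) y < D + e.
  move=> a0 ab b1.
  pose u (i : nat) : R := if i is i'.+1 then
    if i' is i''.+1 then if i'' is 0%N then b else 1 else a else 0.
  have := sumE 3%N u; rewrite !big_ord_recr big_ord0/= add0r c0 c1; apply.
    by move=> [|[|[|i]]] /=; lra.
  by move=> [|[|[|i]]] /=; lra.
have cd : {within `[0, 1], continuous (d x \o c)}.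
  apply: within_continuous_comp cc => z _; exact: mdist_continuous.
have ivt s : exists t, 0 <= s <= D -> 0 <= t <= 1 /\ d x (c t) = s.
  have [sD|] := pselect (0 <= s <= D); last by exists 0.
  have [|t] := @IVT R (d x \o c) 0 1 s ler01 cd.
    rewrite /= c0 c1 mdistxx -/D.
    by rewrite min_l ?max_r//; case/andP: sD => *; lra.
  by rewrite in_itv/= => t01 ts; exists t.
have [tau tauP] := choice ivt.
exists (c \o tau); split => /=.
- by move=> s /tauP[].
- move=> s /tauP[/andP[t0 t1] ts].
  have := sum3 _ _ t0 (lexx _) t1; rewrite mdistxx ts; lra.
- have main s t : 0 <= s <= D -> 0 <= t <= D -> tau s <= tau t ->
      d (c (tau s)) (c (tau t)) <= `|s - t| + e.
    move=> /tauP[/andP[s0 s1] ss] /tauP[/andP[t0 t1] tt] st.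
    have := sum3 _ _ s0 st t1; rewrite ss.
    have := metric_triangle x (c (tau t)) y; rewrite tt -/D.
    have := ler_norm (t - s); rewrite distrC; lra.
  move=> s t hs ht; have [st|/ltW ts] := leP (tau s) (tau t); first exact: main.
  by rewrite metric_sym distrC; exact: main.
Qed.

(** Ultrafilters replace subsequences throughout: a limit exists at once for all
parameters simultaneously, without a diagonal argument. *)
Lemma ultra_cvg_compact (X : Type) (F : set_system X) (T : topologicalType)
    (g : X -> T) (C : set T) : UltraFilter F -> compact C ->
  F (g @^-1` C) -> exists2 p, C p & g @ F --> p.
Proof.
move=> UF cC FC; have [p [Cp clp]] := cC (g @ F) _ FC.
exists p => // V Vp; have [//|FV] := in_ultra_setVsetC (g @^-1` V) UF.
by have [z []] := clp (~` V) V FV Vp.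
Qed.

(** Total boundedness plus completeness, with compact nets in place of finite
ones: pushing an ultrafilter to a compact net makes it converge there, which
shows that the ultrafilter itself is Cauchy. *)
Lemma compact_of_compact_nets (A : set M) : complete_space M -> closed A ->
  (forall e, 0 < e -> exists2 C, compact C &
    forall y, A y -> exists2 z, C z & d z y <= e) -> compact A.
Proof.
move=> cM cA net; rewrite compact_ultra => F UF FA.
have [|p Fp] := cM F _; last first.
  exists p; split => //; apply: (@closed_cvg _ _ F _ id A) => //.
apply: cauchy_exP => e e0.
have e20 : 0 < e / 2 by rewrite divr_gt0.
have [C cC AC] := net _ e20.
have /choice[h hP] y : exists z, A y -> C z /\ d z y <= e / 2.
  have [Ay|] := pselect (A y); last by exists y.
  by have [z] := AC _ Ay; exists z.
have [|p Cp hp] := ultra_cvg_compact (g := h) UF cC.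
  by apply: filterS FA => y /hP[].
exists p; have Fb : F (h @^-1` (ball p (e / 2))) by apply: hp; exact: nbhsx_ballx.
apply: filterS2 Fb FA => y /=; rewrite !ballEmdist/= => py /hP[_ hy].
by apply: le_lt_trans (metric_triangle _ (h y) _) _; lra.
Qed.

Lemma locally_compact_mball x : locally_compact [set: M] ->
  exists2 r, 0 < r & compact (mball x r).
Proof.
move=> /(_ x I); rewrite withinET => -[B xB [cB clB]].
move: xB; rewrite -filter_from_ballE => -[r /= r0 rB].
exists (r / 2); first by rewrite divr_gt0.
apply: (subclosed_compact _ cB); first exact: mball_closed.
by move=> y xy; apply: rB; rewrite ballEmdist/=; apply: le_lt_trans xy _; lra.
Qed.

Lemma compact_mballS x r s : r <= s -> compact (mball x s) -> compact (mball x r).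
Proof.
move=> rs cs; apply: (subclosed_compact _ cs); first exact: mball_closed.
by move=> y /le_trans; apply.
Qed.

(** In a length space an almost minimizing curve from the center to a point slightly
outside a ball passes through a nearby point of the ball. *)
Lemma mball_net x r e : length_space M -> 0 <= r -> 0 < e ->
  forall y, d x y <= r + e -> exists2 z, mball x r z & d z y <= e + e.
Proof.
move=> lM r0 e0 y xy; have [T [T1 T2 _]] := approx_segment x y lM e0.
have y0 := mdist_ge0 x y.
have hm : 0 <= Num.min r (d x y) <= d x y.
  by rewrite le_min r0 y0 ge_min lexx orbT.
exists (T (Num.min r (d x y))); rewrite /mball/=.
  by rewrite T1// ge_min lexx.
apply: le_trans (T2 _ hm) _; rewrite minEle; case: ifPn => h; lra.
Qed.

Lemma ultra_meet (X : Type) (F : set_system X) (A B : set X) : UltraFilter F ->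
  F A -> F B -> exists i, A i /\ B i.
Proof. by move=> UF FA FB; apply: (@filter_ex _ F _ (A `&` B)); exact: filterI. Qed.

Lemma ultra_nat : exists U : set_system nat, UltraFilter U /\ \oo `<=` U.
Proof. exact: ultraFilterLemma. Qed.

(** Otherwise points [z n] of [C] whose balls of radius [1 / (n + 1)] are not compact
would accumulate at a point without compact neighborhood. *)
Lemma compact_uniform_mball (C : set M) : locally_compact [set: M] ->
  compact C -> exists2 e, 0 < e & forall z, C z -> compact (mball z e).
Proof.
move=> lM cC; apply: contrapT => noe.
have bad n : exists z, C z /\ ~ compact (mball z n.+1%:R^-1).
  apply: contrapT => nz; apply: noe; exists n.+1%:R^-1; first by rewrite invr_gt0.
  by move=> z Cz; apply: contrapT => ncz; apply: nz; exists z.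
have [z zP] := choice bad.
have [U [UU oU]] := ultra_nat.
have [|p Cp zp] := ultra_cvg_compact (g := z) UU cC.
  by apply: filterS filterT => n _ /=; have [] := zP n.
have [r r0 cr] := locally_compact_mball p lM.
have r20 : 0 < r / 2 by rewrite divr_gt0.
have U1 : U (z @^-1` ball p (r / 2)) by apply: zp; exact: nbhsx_ballx.
have U2 : U [set n | n.+1%:R^-1 < r / 2].
  by apply: oU; exact: near_infty_natSinv_lt (PosNum r20).
have [n [/= + nr]] := ultra_meet UU U1 U2.
rewrite ballEmdist/= => pz; have [_] := zP n; apply.
apply: (subclosed_compact _ cr); first exact: mball_closed.
move=> y; rewrite /mball/= => zy.
apply: le_trans (metric_triangle _ (z n) _) _.
by apply: le_trans (lerD (ltW pz) (le_trans zy (ltW nr))) _; lra.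
Qed.

(** The set of radii with compact balls is closed, by completeness, and open, by
local compactness; here both facts are applied at its supremum. *)
Lemma compact_mball x r : complete_space M -> locally_compact [set: M] ->
  length_space M -> compact (mball x r).
Proof.
move=> cM kM lM; apply: contrapT => ncr.
pose S := [set s | 0 <= s /\ compact (mball x s)].
have c0 : compact (mball x 0).
  have [e e0] := locally_compact_mball x kM.
  by apply: compact_mballS; exact: ltW.
have hS : has_sup S.
  split; first by exists 0; split.
  exists r => s [_ cs]; rewrite leNgt; apply/negP => rs.
  by apply: ncr; apply: compact_mballS cs; exact: ltW.
have sup0 : 0 <= sup S by apply: sup_upper_bound => //; split.
have below s : s < sup S -> compact (mball x s).
  move=> /(sup_gt hS.1)[s' [_ cs'] ss'].
  by apply: compact_mballS cs'; exact: ltW.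
have csup : compact (mball x (sup S)).
  apply: compact_of_compact_nets => // [|e e0]; first exact: mball_closed.
  have e20 : 0 < e / 2 by rewrite divr_gt0.
  exists (mball x (Num.max 0 (sup S - e / 2))).
    rewrite maxEle; case: ifPn => // _; apply: below; lra.
  move=> y xy; have -> : e = e / 2 + e / 2 by lra.
  apply: mball_net => //; first by rewrite le_max lexx.
  apply: le_trans xy _; rewrite maxEle; case: ifPn => ?; lra.
have [e e0 ce] := compact_uniform_mball kM csup.
suff : S (sup S + e / 4).
  by move=> /(sup_upper_bound hS); rewrite leNgt ltrDl divr_gt0.
split; first by apply: addr_ge0 => //; rewrite ltW// divr_gt0.
have e40 : 0 < e / 4 by rewrite divr_gt0.
rewrite compact_ultra => F UF FA.
have /choice[h hP] y : exists z, d x y <= sup S + e / 4 ->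
    mball x (sup S) z /\ d z y <= e / 2.
  have [Ay|] := pselect (d x y <= sup S + e / 4); last by exists y.
  by have [z xz zy] := mball_net lM sup0 e40 Ay; exists z => _; split => //; lra.
have [|p Cp hp] := ultra_cvg_compact (g := h) UF csup.
  by apply: filterS FA => y /hP[].
have Fb : F (h @^-1` ball p (e / 4)) by apply: hp; exact: nbhsx_ballx.
have Fe : F (mball p e).
  apply: filterS2 Fb FA => y /=; rewrite !ballEmdist/= => py /hP[_ hy].
  by apply: le_trans (metric_triangle _ (h y) _) _; lra.
have [q qe Fq] := ultra_cvg_compact (g := id) UF (ce _ Cp) Fe.
exists q; split => //.
by apply: (@closed_cvg _ _ F _ id (mball x (sup S + e / 4))) => //; exact: mball_closed.
Qed.

(** Only [d (S s) (S t) <= |s - t|] survives the limit directly; equality follows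
because [S] joins two points at distance exactly [d x y]. *)
Lemma segment_exists x y : complete_space M -> locally_compact [set: M] ->
  length_space M -> exists T, segment d x y T.
Proof.
move=> cM kM lM; have /choice[T TP] := fun n : nat =>
  approx_segment x y lM (ltac:(by rewrite invr_gt0) : 0 < n.+1%:R^-1 :> R).
have [U [UU oU]] := ultra_nat.
set D := d x y in TP *.
have lim s : exists z, 0 <= s <= D -> (T ^~ s) @ U --> z.
  have [sD|] := pselect (0 <= s <= D); last by exists x.
  have [|z _ zs] := ultra_cvg_compact (g := T ^~ s) UU (@compact_mball x D cM kM lM).
    apply: filterS filterT => n _ /=; rewrite /mball/=.
    by have [-> //] := TP n; case/andP: sD.
  by exists z.
have [S SP] := choice lim.
have D0 : 0 <= D by exact: mdist_ge0.
have near1 s e : 0 <= s <= D -> 0 < e -> U [set n | d (S s) (T n s) < e].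
  move=> /SP zs e0; have zb := zs (ball (S s) e) (nbhsx_ballx _ _ e0).
  by apply: (@filterS _ U _ _ _ _ zb) => n /=; rewrite ballEmdist.
have small e : 0 < e -> U [set n | n.+1%:R^-1 < e].
  by move=> e0; apply: oU; exact: near_infty_natSinv_lt (PosNum e0).
have lip s t : 0 <= s <= D -> 0 <= t <= D -> d (S s) (S t) <= `|s - t|.
  move=> sD tD; apply/ler_addgt0Pl => e e0.
  have e30 : 0 < e / 3 by rewrite divr_gt0.
  have [n [/= h1 [h2 h3]]] := ultra_meet UU (near1 _ _ sD e30)
    (filterI (near1 _ _ tD e30) (small _ e30)).
  have [_ _ /(_ _ _ sD tD)] := TP n.
  have := metric_triangle (S s) (T n s) (S t).
  have := metric_triangle (T n s) (T n t) (S t).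
  rewrite (metric_sym (T n t) (S t)).
  move: h1 h2 h3; move: (n.+1%:R^-1) => k; lra.
have D1 : (0 : R) <= 0 <= D by rewrite lexx.
have D2 : 0 <= D <= D by rewrite lexx andbT.
have S0 : S 0 = x.
  apply/esym/mdist_positivity/eqP; rewrite eq_le mdist_ge0 andbT.
  apply/ler_addgt0Pl => e e0.
  have [n [/= h1 _]] := ultra_meet UU (near1 _ _ D1 e0) filterT.
  have [/(_ _ D1) h2 _ _] := TP n.
  have := metric_triangle x (T n 0) (S 0).
  rewrite (metric_sym (T n 0) (S 0)); lra.
have SD : S D = y.
  apply/mdist_positivity/eqP; rewrite eq_le mdist_ge0 andbT.
  apply/ler_addgt0Pl => e e0; have e20 : 0 < e / 2 by rewrite divr_gt0.
  have [n [/= h1 h3]] := ultra_meet UU (near1 _ _ D2 e20) (small _ e20).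
  have [_ /(_ _ D2) h2 _] := TP n.
  move: (metric_triangle (S D) (T n D) y) h1 h2 h3.
  by move: (n.+1%:R^-1) => k; lra.
exists S; split => // s t sD tD.
have main a b : 0 <= a <= D -> 0 <= b <= D -> a <= b -> d (S a) (S b) = `|a - b|.
  move=> aD bD ab; apply/eqP; rewrite eq_le lip//=.
  have := lip _ _ D1 aD; have := lip _ _ bD D2.
  have := metric_triangle x (S a) y; have := metric_triangle (S a) (S b) y.
  rewrite S0 SD -/D sub0r normrN (ger0_norm (x := a)); last by case/andP: aD.
  rewrite distrC ger0_norm ?subr_ge0; last by case/andP: bD.
  rewrite distrC ger0_norm ?subr_ge0//; lra.
have [st|/ltW ts] := leP s t; first exact: main.
by rewrite metric_sym distrC; exact: main.
Qed.

End MetricGeometry.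

(** * Ends and straight lines *)

Section Ends.
Context {R : realType} (M : metricType R) (o : M).
Implicit Types (x y z p q : M) (r s t e : R).
Local Notation d := (@mdist R M).

(** The inequality fails as soon as a minimizing segment from [p] to [q] comes
within [rho] of [o]: it expresses that segments between far points avoid any
given ball around [o]. *)
Definition short_chords : Prop := forall rho, exists r, forall p q,
  r <= d o p -> r <= d o q -> d p q < d o p + d o q - 2 * rho.

Lemma minimizing_segment_connected x y (T : R -> M) : segment d x y T ->
  connected (T @` `[0, d x y]).
Proof.
move=> [_ _ dT]; apply: connected_continuous_connected; first exact: segment_connected.
apply/subspace_continuousP => s /= sD; rewrite in_itv/= in sD.
apply/metricType_numDomainType.cvgrPdist_lt => e e0.
have : nbhs s (ball s e) by exact: nbhsx_ballx.
rewrite near_withinE; apply: filterS => t st /= tD; rewrite in_itv/= in tD.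
by rewrite dT.
Qed.

(** The segment of the line from [g (- t)] to [g t] passes through [g 0], so its
length is at least [d o (g (- t)) + d o (g t) - 2 * d o (g 0)] for all [t]. *)
Lemma no_straight_line : short_chords -> ~ exists g, straight_line d g.
Proof.
move=> short [g gl]; have [r rP] := short (d o (g 0)).
set rho := d o (g 0) in rP.
have rho0 : 0 <= rho by exact: mdist_ge0.
pose t := Num.max r 0 + rho.
have t0 : 0 <= t by rewrite addr_ge0// le_max lexx orbT.
have tr : r + rho <= t by rewrite lerD2r le_max lexx.
have h1 := metric_triangle o (g 0) (g t); have h2 := metric_triangle (g 0) o (g t).
have h3 := metric_triangle o (g 0) (g (- t)).
have h4 := metric_triangle (g 0) o (g (- t)).
rewrite !(metric_sym _ o) -/rho !gl !sub0r ?opprK ?normrN ger0_norm// in h1 h2 h3 h4.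
have := rP (g (- t)) (g t); rewrite gl.
have -> : - t - t = - (t + t) by ring.
have tt0 : 0 <= t + t by lra.
rewrite normrN ger0_norm//.
move=> H; have : t + t < d o (g (- t)) + d o (g t) - 2 * rho by apply: H; lra.
lra.
Qed.

Lemma compact_mdist_bounded (C : set M) : compact C ->
  exists r, forall x, C x -> d o x <= r.
Proof.
move=> cC; have [C0|/set0P/negP/negPn/eqP ->] := pselect (C !=set0); last by exists 0.
have [|c _ cP] := compact_EVT_max (f := d o) C0 cC.
  by apply: continuous_subspaceT => x; exact: mdist_continuous.
by exists (d o c) => x Cx; apply: cP; rewrite inE.
Qed.

Context (cballs : forall r : R, compact [set x | d o x <= r])
  (segs : forall x y, exists T, segment d x y T) (short : short_chords).

(** A minimizing segment from [p] to [q] that met [C] would pass within [rho] of [o],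
where [rho] bounds [C]. *)
Lemma far_points_connected (C : set M) : compact C -> exists r,
  (forall x, C x -> d o x <= r) /\
  (forall p q, r < d o p -> r < d o q -> connected_component (~` C) p q).
Proof.
move=> cC; have [rho rhoP] := compact_mdist_bounded cC.
have [r rP] := short rho; exists (Num.max rho r); split.
  by move=> x /rhoP xr; rewrite le_max xr.
move=> p q; rewrite !gt_max => /andP[rp1 rp2] /andP[rq1 rq2].
have [T T_] := segs p q; exists (T @` `[0, d p q]); last first.
  exists (d p q); last by have [_ -> _] := T_.
  by rewrite /= in_itv/= mdist_ge0 lexx.
split.
- exists 0; last by have [-> _ _] := T_.
  by rewrite /= in_itv/= mdist_ge0 lexx.
- move=> _ [s sD <-] /rhoP; rewrite leNgt => /negP; apply.
  rewrite /= in_itv/= in sD.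
  have [T0 TD dT] := T_; have D0 := mdist_ge0 p q.
  have h1 : d p (T s) = s.
    by rewrite -{1}T0 dT ?lexx// sub0r normrN ger0_norm//; case/andP: sD.
  have h2 : d (T s) q = d p q - s.
    by rewrite -{1}TD dT ?lexx ?D0// distrC ger0_norm// subr_ge0; case/andP: sD.
  have := rP _ _ (ltW rp2) (ltW rq2).
  have := metric_triangle o (T s) p; have := metric_triangle o (T s) q.
  rewrite (metric_sym (T s) p) h1 h2; lra.
- exact: minimizing_segment_connected T_.
Qed.

(** The unique end picks the component of the complement of [C] that contains all
far points.  Any end agrees with it: the component that it selects outside a
large ball containing [C] consists of far points, and lies in the one that it
selects outside [C]. *)
Lemma one_end : ~ compact [set: M] -> has_one_end M.
Proof.
move=> ncM.
(* M is unbounded, since its balls are compact *)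
have far r : exists p, r < d o p.
  apply: contrapT => nf; apply: ncM; have -> // : [set: M] = [set x | d o x <= r].
  apply/seteqP; split => // x _ /=; rewrite leNgt; apply/negP => rx.
  by apply: nf; exists x.
(* [(b C).1] is a far point, [(b C).2] the radius beyond which points are far *)
have /choice[b bP] (C : set M) : exists xr : M * R, compact C ->
    [/\ xr.2 < d o xr.1, forall x, C x -> d o x <= xr.2 &
      forall q, xr.2 < d o q -> connected_component (~` C) xr.1 q].
  have [cC|] := pselect (compact C); last by exists (o, 0).
  have [r [r1 r2]] := far_points_connected cC; have [p rp] := far r.
  by exists (p, r) => _; split => //= q; exact: r2.
have out C r x : (forall y, C y -> d o y <= r) -> r < d o x -> (~` C) x.
  by move=> Cr rx /Cr; rewrite leNgt rx.
have mono (C D : set M) x y : C `<=` D -> connected_component (~` D) x y ->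
    connected_component (~` C) x y.
  move=> CD [B [Bx BD cB] By]; exists B => //; split => // z Bz Cz.
  exact: BD Bz (CD _ Cz).
exists (fun C => connected_component (~` C) (b C).1).
  split.
    move=> C cC; have [b1 b2 b3] := bP C cC.
    by exists (b C).1 => //; exact: out b2 b1.
  move=> C D cC cD CD y yD; have [b1 b2 b3] := bP C cC; have [a1 a2 a3] := bP D cD.
  have [p] := far (Num.max (b C).2 (b D).2); rewrite gt_max => /andP[p1 p2].
  apply: connected_component_trans (b3 _ p1) _.
  apply: connected_component_trans (connected_component_sym (mono _ _ _ _ CD (a3 _ p2))) _.
  exact: mono CD yD.
move=> e' [e1 e2] C cC; have [b1 b2 b3] := bP C cC.
(* compare the values of [e'] at [C] and at the ball of radius [(b C).2] *)
have [x Cx ex] := e1 _ (@cballs (b C).2).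
have xb : (b C).2 < d o x by rewrite ltNge; apply/negP.
have [x' Cx' ex'] := e1 _ cC.
have xx' : connected_component (~` C) x' x.
  rewrite -ex'; apply: (e2 _ _ cC (@cballs (b C).2)) => //.
  by rewrite ex; exact: connected_component_refl.
rewrite ex' (same_connected_component xx').
by apply/esym/same_connected_component; exact: b3.
Qed.

End Ends.

(** * Growth of the profile under positive total curvature *)

Section Curvature.
Context {R : realType}.
Notation mu := (@lebesgue_measure R).
Local Open Scope ereal_scope.

Lemma ge0_integral_fst (phi : R -> \bar R) (A B : set R) :
  measurable A -> measurable B -> measurable_fun A phi ->
  (forall x, A x -> 0 <= phi x) ->
  \int[mu \x mu]_(z in A `*` B) phi z.1 = (\int[mu]_(x in A) phi x) * mu B.
Proof.
move=> mA mB mphi phi0.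
have mphiA : measurable_fun setT (phi \_ A) by apply/(measurable_restrictT phi).
have phiA0 x : 0 <= (phi \_ A) x by apply: erestrict_ge0.
rewrite integral_mkcond.
pose h (z : R * R) := (phi \_ A) z.1 * (\1_B z.2)%:E.
rewrite (_ : (fun z => phi z.1) \_ (A `*` B) = h); last first.
  apply/funext => -[x y]; rewrite /h /patch/= indicE in_setX/=.
  by case: (x \in A); case: (y \in B); rewrite /= ?mule1 ?mule0 ?mul0e.
rewrite fubini_tonelli1//; last 2 first.
- apply: emeasurable_funM.
    by apply: measurableT_comp => //; exact: measurable_fst.
  by apply/measurable_EFinP; apply: measurableT_comp => //; exact: measurable_snd.
- by move=> z; rewrite /h mule_ge0// lee_fin.
rewrite /fubini_F [in RHS]integral_mkcond -ge0_integralZr//.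
apply: eq_integral => x _; rewrite /h/= ge0_integralZl//.
- by rewrite integral_indic// setIT.
- exact/measurable_EFinP/measurable_indic.
Qed.

(** A positive integral has a finite negative part, smaller than the positive
part; the latter is exhausted by the intervals [[0, n]], while enlarging the
interval cannot raise the negative part above its total. *)
Lemma integral_pos_truncation (G : R -> R) (B : set R) :
  {within `[0%R, +oo[, continuous G} -> measurable B -> mu B < +oo ->
  0 < \int[mu \x mu]_(z in `[0%R, +oo[ `*` B) (G z.1)%:E ->
  exists2 e : R, (0 < e)%R & exists n : nat, forall r : R, (n%:R <= r)%R ->
    (e <= \int[mu]_(x in `[0%R, r]) G x)%R.
Proof.
move=> cG mB Bfin tot.
set A : set R := (`[0%R, +oo[)%classic in cG tot.
pose g := EFin \o G.
have mA : measurable A by exact: measurable_itv.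
have mg : measurable_fun A g.
  by apply/measurable_EFinP; apply: subspace_continuous_measurable_fun.
have mgp : measurable_fun A g^\+ by exact: measurable_funepos.
have mgn : measurable_fun A g^\- by exact: measurable_funeneg.
have sub (r : R) : `[0%R, r] `<=` A.
  by move=> x; rewrite /A /= !in_itv/= andbT => /andP[].
have mgpr (r : R) : measurable_fun `[0%R, r] g^\+.
  by apply: measurable_funS mgp.
have ig (r : R) : mu.-integrable `[0%R, r] g.
  apply: continuous_compact_integrable; first exact: segment_compact.
  by apply: continuous_subspaceW cG; exact: sub.
move: tot; rewrite integralE.
have -> : (fun z : R * R => (G z.1)%:E)^\+ = (fun z => g^\+ z.1).
  by apply/funext => z; rewrite !funeposE.
have -> : (fun z : R * R => (G z.1)%:E)^\- = (fun z => g^\- z.1).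
  by apply/funext => z; rewrite !funenegE.
rewrite !ge0_integral_fst//.
set P := \int[mu]_(x in A) g^\+ x; set Q := \int[mu]_(x in A) g^\- x.
have P0 : 0 <= P by apply: integral_ge0.
have Q0 : 0 <= Q by apply: integral_ge0.
have B0 : 0 <= mu B by [].
case: (mu B) Bfin B0 => [b| |]// _; rewrite lee_fin le_eqVlt => /predU1P[<-|b0].
  by rewrite !mule0 sube0 ltxx.
move=> tot.
have Qfin : Q \is a fin_num.
  case: Q Q0 tot => [q| |]// _.
  by rewrite gt0_mulye ?lte_fin//= addeNy ltNge leNye.
have QP : Q < P.
  move: tot; rewrite sube_gt0.
  by rewrite lte_pmul2r// lte_fin.
have [n Qn] : exists n : nat, Q < \int[mu]_(x in `[0%R, n%:R]) g^\+ x.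
  apply: contrapT => /forallNP nQ.
  suff : P <= Q by rewrite leNgt QP.
  have Aun : A = \bigcup_n `[0%R, n%:R]%classic.
    apply/seteqP; split => [x|x [n _]]; last exact: sub.
    rewrite /A/= in_itv/= andbT => x0; exists (Num.truncn x).+1 => //=.
    by rewrite in_itv/= x0/= ltW// truncnS_gt.
  suff : \int[mu]_(x in `[0%R, n%:R]) g^\+ x @[n --> \oo] --> P.
    apply: cvge_le; apply: nearW => n; rewrite leNgt; apply/negP; exact: nQ.
  rewrite /P Aun; apply: ge0_nondecreasing_set_cvg_integral => //.
  - move=> n m nm; apply/subsetPset => x /=; rewrite !in_itv/= => /andP[-> xn]/=.
    by rewrite (le_trans xn)// ler_nat.
  - by move=> n; exact: mgpr.
have pfin : \int[mu]_(x in `[0%R, n%:R]) g^\+ x \is a fin_num.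
  exact: integrable_pos_fin_num.
exists (fine (\int[mu]_(x in `[0%R, n%:R]) g^\+ x) - fine Q)%R.
  by rewrite subr_gt0 fine_lt.
exists n => r nr.
rewrite /Rintegral [in leRHS]integralE.
rewrite [leRHS]fineB; [|exact: (integrable_pos_fin_num _ (ig r))|
  exact: (integrable_neg_fin_num _ (ig r))].
apply: lerB; apply: fine_le => //.
- exact: (integrable_pos_fin_num _ (ig r)).
- apply: ge0_subset_integral => //; first exact: mgpr.
  by move=> x /=; rewrite !in_itv/= => /andP[-> /le_trans]; apply.
- exact: (integrable_neg_fin_num _ (ig r)).
- by apply: ge0_subset_integral => //; exact: sub.
Qed.

End Curvature.

Section Growth.
Context {R : realType} (K f : R -> R) (hf : surface_of_revolution K f).
Notation mu := (@lebesgue_measure R).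

Lemma profile_cvg0 : f h @[h --> 0^'+] --> (0 : R).
Proof.
have h0 : (h : R) @[h --> 0^'+] --> (0 : R).
  exact: cvg_within.
have : f h / h * h @[h --> 0^'+] --> (1 * 0 : R) by exact: cvgM (sor_df0 hf) h0.
rewrite mulr0; apply: cvg_trans; apply: near_eq_cvg.
by near=> h; rewrite divfK// gt_eqF.
Unshelve. all: by end_near. Qed.

Lemma profile_continuous : {within `[0, +oo[, continuous f}.
Proof.
apply/continuous_within_itvcyP; split; last by rewrite (sor_f0 hf); exact: profile_cvg0.
move=> x; rewrite in_itv/= andbT => x0.
exact/differentiable_continuous/derivable1_diffP/(sor_f_derivable hf).
Qed.

Lemma curvature_density_continuous : {within `[0, +oo[, continuous (fun r => K r * f r)}.
Proof.
move=> x; apply: continuousM; last exact: profile_continuous.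
exact: (sor_curvature_continuous hf).
Qed.

Lemma curvature_density_integrable r : mu.-integrable `[0, r] (EFin \o (fun r => K r * f r)).
Proof.
apply: continuous_compact_integrable; first exact: segment_compact.
apply: continuous_subspaceW curvature_density_continuous => x /=.
by rewrite !in_itv/= andbT => /andP[].
Qed.

Lemma derive1_profile_continuous r : 0 < r -> {for r, continuous (derive1 f)}.
Proof.
by move=> r0; exact/differentiable_continuous/derivable1_diffP/(sor_df_derivable hf).
Qed.

Lemma derive1_profileB a b : 0 < a -> a < b ->
  derive1 f a - derive1 f b = \int[mu]_(x in `[a, b]) (K x * f x).
Proof.
move=> a0 ab.
have cG : {within `[a, b], continuous (fun r => K r * f r)}.
  apply: continuous_subspaceW curvature_density_continuous => x /=.
  by rewrite !in_itv/= andbT => /andP[ax _]; rewrite (le_trans _ ax)// ltW.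
have b0 : 0 < b by exact: lt_trans ab.
have := continuous_FTC2 (F := - derive1 f) ab cG.
rewrite /Rintegral => -> /=.
- by rewrite !fctE opprK addrC.
- split.
  + move=> x; rewrite in_itv/= => /andP[ax _]; apply: derivableN.
    by apply: (sor_df_derivable hf); exact: lt_trans ax.
  + apply: cvg_at_right_filter; apply: cvgN; exact: derive1_profile_continuous.
  + apply: cvg_at_left_filter; apply: cvgN; exact: derive1_profile_continuous.
- move=> x; rewrite in_itv/= => /andP[ax _].
  have x0 : 0 < x by exact: lt_trans ax.
  have dx : derivable (derive1 f) x 1 by exact: (sor_df_derivable hf).
  rewrite derive1E deriveN// -derive1E.
  by have /eqP := sor_jacobi hf x0; rewrite addr_eq0 => /eqP ->; rewrite opprK.
Qed.

(** Integrating f'' = - K f from 0.  As f'(0) = 1 is only given as a limit of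
difference quotients, the integration starts at a point [c] near 0 with f'(c)
close to 1, which the mean value theorem provides. *)
Lemma derive1_profile_le r : 0 < r ->
  derive1 f r <= 1 - \int[mu]_(x in `[0, r]) (K x * f x).
Proof.
move=> r0; apply/ler_addgt0Pr => e e0.
have e20 : 0 < e / 2 by rewrite divr_gt0.
have I0 := parameterized_integral_cvg_left r0 (curvature_density_integrable r).
have {}I0 := cvg_at_right_filter I0.
have /cvgrPdist_lt/(_ _ e20) near1 := sor_df0 hf.
have /cvgrPdist_lt/(_ _ e20) near2 := I0.
have nearr : \forall x \near (0:R)^'+, x < r by exact: nbhs_right_lt.
have [eta eta0 etaP] : exists2 eta, 0 < eta & forall x, 0 < x < eta ->
    [/\ `|1 - f x / x| < e / 2, `|\int[mu]_(x in `[0, x]) (K x * f x)| < e / 2 & x < r].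
  have := filterI near1 (filterI near2 nearr).
  move=> [eta /= eta0 etaP]; exists eta => // x /andP[x0 xe].
  have [|h1 [h2 h3]] := etaP x _ x0; first by rewrite /ball/= sub0r normrN gtr0_norm.
  by split=> //; rewrite sub0r normrN in h2.
pose h := eta / 2.
have h0 : 0 < h by rewrite divr_gt0.
have [||c] := @MVT R f (derive1 f) 0 h h0.
- move=> x; rewrite in_itv/= => /andP[x0 _].
  by rewrite derive1E; apply: derivableP; exact: (sor_f_derivable hf).
- apply: continuous_subspaceW profile_continuous => x /=.
  by rewrite !in_itv/= andbT => /andP[].
rewrite in_itv/= => /andP[c0 ch]; rewrite (sor_f0 hf) !subr0 => fh.
have heta : h < eta by rewrite /h ltr_pdivrMr// ltr_pMr// ltr1n.
have [h1 _ _] : _ := etaP h ltac:(by rewrite h0).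
have [_ h2 cr] : _ := etaP c ltac:(by rewrite c0 (lt_trans ch)).
rewrite fh mulfK ?gt_eqF// in h1.
have h3 := derive1_profileB c0 cr.
have h4 := Rintegral_itvB (curvature_density_integrable r) (x := c).
rewrite !bnd_simp in h4; have {}h4 := h4 (ltW c0) (ltW cr).
rewrite Rintegral_itv_obnd_cbnd in h4; last first.
  apply: integrableS (curvature_density_integrable r) => //.
  by apply: subset_itvr; rewrite bnd_simp ltW.
move: h1 h2; rewrite !ltr_norml; lra.
Qed.

(** Once f' <= 1 - e, any slope larger than 1 - e, such as 1 - e / 2, eventually
dominates f. *)
Lemma profile_growth : (0 < total_curvature K f)%E ->
  exists2 k, 0 < k < 1 & exists2 N, 0 < N & forall r, N <= r -> f r <= k * r.
Proof.
move=> tot.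
have [|e e0 [n nP]] := integral_pos_truncation curvature_density_continuous
    (measurable_itv `[0, 2 * pi]) _ tot.
  by rewrite lebesgue_measure_itv/=; case: ifP; rewrite ?ltry// -EFinB ltry.
pose N : R := n%:R + 1.
have N0 : 0 < N by rewrite ltr_wpDl.
have dle r : N <= r -> derive1 f r <= 1 - e.
  move=> Nr; apply: le_trans (derive1_profile_le _) _; first exact: lt_le_trans Nr.
  by rewrite lerD2l lerN2 nP// (le_trans _ Nr)// lerDl.
pose k := Num.max (1 / 2) (1 - e / 2).
have k0 : 1 / 2 <= k by rewrite le_max lexx.
have ke : 1 - e / 2 <= k by rewrite le_max lexx orbT.
have k1 : k < 1 by rewrite gt_max; apply/andP; split; lra.
exists k; first by apply/andP; split; lra.
(* the line of slope 1 - e through (N, f N) is below k r from there on *)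
pose N' := N + 2 / e * (f N).
have fN0 : 0 < f N by exact: (sor_f_gt0 hf).
have N'N : N <= N' by rewrite lerDl mulr_ge0// ?divr_ge0// ltW.
exists N'; first exact: lt_le_trans N'N.
move=> r rN'; have Nr : N <= r by exact: le_trans rN'.
have [||c] := @MVT_segment R f (derive1 f) N r Nr.
- move=> x; rewrite in_itv/= => /andP[x0 _].
  rewrite derive1E; apply: derivableP; apply: (sor_f_derivable hf).
  exact: lt_trans x0.
- apply: continuous_subspaceW profile_continuous => x /=.
  by rewrite !in_itv/= andbT => /andP[Nx _]; rewrite (le_trans _ Nx)// ltW.
rewrite in_itv/= => /andP[Nc _] fr.
have h1 : f r <= f N + (1 - e) * (r - N).
  by rewrite -lerBlDl fr ler_wpM2r ?subr_ge0// dle.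
have h2 : f N <= e / 2 * (r - N).
  rewrite mulrC -ler_pdivrMr ?divr_gt0// invf_div mulrC lerBrDl; exact: rN'.
have h3 : (1 - e / 2) * r <= k * r by rewrite ler_wpM2r// (le_trans _ Nr)// ltW.
have : 0 < e / 2 * N by rewrite mulr_gt0// divr_gt0.
have : e * N = 2 * (e / 2 * N) by field.
nra.
Qed.
End Growth.

(** * Lengths of arcs on the surface of revolution *)

Local Notation rad := Defs.rad.

Section ArcTools.
Context {R : realType}.
Notation mu := (@lebesgue_measure R).

(** The integral of a nonnegative function is a supremum over the simple functions
below it, hence is monotone without any measurability.  This makes it possible to
estimate lengths of arcs without discussing the regularity of [riem_norm]. *)
Lemma ge0_le_integral_sup (D : set R) (f g : R -> \bar R) :
  (forall x, D x -> 0 <= f x <= g x)%E ->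
  (\int[mu]_(x in D) f x <= \int[mu]_(x in D) g x)%E.
Proof.
move=> fg; rewrite !ge0_integralE; first last.
- by move=> x /fg/andP[].
- by move=> x /fg/andP[]; exact: le_trans.
apply: le_ereal_sup => _ [h hf <-]; exists h => //= x.
apply: le_trans (hf x) _; rewrite /patch; case: ifPn => //.
by rewrite inE => /fg/andP[].
Qed.

Lemma le_Rintegral01 (g : R -> R) (c : R) : (forall t, 0 <= t <= 1 -> 0 <= g t <= c) ->
  \int[mu]_(t in `[0, 1]) g t <= c.
Proof.
move=> gc.
have c0 : 0 <= c by have /andP[] := gc 0 (ltac:(by rewrite lexx ler01)); exact: le_trans.
have intc : (\int[mu]_(t in `[0%R, 1%R]) (cst c%:E) t = c%:E)%E.
  by rewrite integral_cst//= lebesgue_measure_itv/= lte_fin ltr01 sube0 mule1.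
have le1 : (\int[mu]_(t in `[0%R, 1%R]) (g t)%:E <= c%:E)%E.
  rewrite -intc; apply: ge0_le_integral_sup => t /=; rewrite in_itv/= => /gc.
  by rewrite !lee_fin.
rewrite /Rintegral -[leRHS]/(fine c%:E); apply: fine_le => //.
rewrite ge0_fin_numE; first by rewrite (le_lt_trans le1)// ltry.
by apply: integral_ge0 => t /=; rewrite in_itv/= lee_fin => /gc/andP[].
Qed.

(** The constant [c] ensures that the integral of [g] is finite: the real-valued
integral would otherwise be zero. *)
Lemma FTC_le (F dF g : R -> R) (c : R) :
  (forall t : R, is_derive t 1 F (dF t)) -> continuous dF ->
  (forall t, 0 <= t <= 1 -> dF t <= g t) ->
  (forall t, 0 <= t <= 1 -> 0 <= g t <= c) ->
  F 1 - F 0 <= \int[mu]_(t in `[0, 1]) g t.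
Proof.
move=> dFE cdF dFg gc.
have cF : continuous F.
  move=> t; apply/differentiable_continuous/derivable1_diffP.
  exact: (@ex_derive _ _ _ _ _ _ _ (dFE t)).
have E : (\int[mu]_(t in `[0%R, 1%R]) (dF t)%:E = (F 1 - F 0)%:E)%E.
  rewrite (continuous_FTC2 (F := F) ltr01) ?EFinB//.
  - exact: continuous_subspaceT.
  - split.
    + by move=> t _; exact: (@ex_derive _ _ _ _ _ _ _ (dFE t)).
    + by apply: cvg_at_right_filter; exact: cF.
    + by apply: cvg_at_left_filter; exact: cF.
  - by move=> t _; rewrite derive1E; exact: (@derive_val _ _ _ _ _ _ _ (dFE t)).
have le1 : (\int[mu]_(t in `[0%R, 1%R]) (dF t)%:E <= \int[mu]_(t in `[0%R, 1%R]) (g t)%:E)%E.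
  rewrite integralE.
  apply: (@le_trans _ _ (\int[mu]_(t in `[0%R, 1%R]) (fun t => (dF t)%:E)^\+ t)%E).
    rewrite -[leRHS]sube0; apply: leeB => //; apply: integral_ge0 => t _.
    exact: funeneg_ge0.
  apply: ge0_le_integral_sup => t /=; rewrite in_itv/= => t01.
  rewrite funepos_ge0/= funeposE ge_max !lee_fin dFg//=.
  by have /andP[] := gc _ t01.
have fin : (\int[mu]_(t in `[0%R, 1%R]) (g t)%:E)%E \is a fin_num.
  rewrite ge0_fin_numE; last first.
    by apply: integral_ge0 => t /=; rewrite in_itv/= lee_fin => /gc/andP[].
  apply: le_lt_trans (ltry c).
  have -> : (c%:E = \int[mu]_(t in `[0%R, 1%R]) (cst c%:E) t)%E.
    by rewrite integral_cst//= lebesgue_measure_itv/= lte_fin ltr01 sube0 mule1.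
  by apply: ge0_le_integral_sup => t /=; rewrite in_itv/= !lee_fin => /gc.
by rewrite /Rintegral -lee_fin fineK// -E.
Qed.

Lemma C1_of_is_derive (g dg : R -> R) : (forall t : R, is_derive t 1 g (dg t)) ->
  continuous dg -> C1 g /\ derive1 g = dg.
Proof.
move=> gd cdg; have E : derive1 g = dg.
  by apply/funext => t; rewrite derive1E; exact: (@derive_val _ _ _ _ _ _ _ (gd t)).
by split=> //; split; [move=> t; exact: (@ex_derive _ _ _ _ _ _ _ (gd t))|rewrite E].
Qed.

End ArcTools.

Section PolarArcs.
Context {R : realType} (f : R -> R).
Implicit Types (x y z : R * R) (r a b c t : R).

Lemma rad_polar r a : rad (polar r a) = `|r|.
Proof.
rewrite /rad/= !exprMn -mulrDr cos2Dsin2 mulr1; exact: sqrtr_sqr.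
Qed.

Lemma riem_norm_ge0 z w : 0 <= riem_norm f z w.
Proof. by rewrite /riem_norm; case: ifP => _; exact: sqrtr_ge0. Qed.

(** The second argument is the velocity of a curve [polar rho theta] with
[rho' = u] and [theta' = v].  At the origin only the radial part [u] remains. *)
Lemma riem_norm_polar r a u v : 0 <= r ->
  riem_norm f (polar r a) (u * cos a - r * sin a * v, u * sin a + r * cos a * v) =
  Num.sqrt (u ^+ 2 + (if r == 0 then 0 else f r * v) ^+ 2).
Proof.
move=> r0; rewrite /riem_norm rad_polar normr_eq0 ger0_norm//.
have cs := cos2Dsin2 a.
case: eqVneq => [->|rn0].
  rewrite !mul0r subr0 addr0 expr0n/= addr0 /rad/= !exprMn -mulrDr cs mulr1//.
congr (Num.sqrt (_ ^+ 2 + (f r * _) ^+ 2)); rewrite /=.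
- have -> : r * cos a * (u * cos a - r * sin a * v) +
    r * sin a * (u * sin a + r * cos a * v) = r * u * (cos a ^+ 2 + sin a ^+ 2) by ring.
  by rewrite cs mulr1 mulrAC mulfV// mul1r.
- have -> : r * cos a * (u * sin a + r * cos a * v) -
    r * sin a * (u * cos a - r * sin a * v) = r ^+ 2 * v * (cos a ^+ 2 + sin a ^+ 2) by ring.
  by rewrite cs mulr1 mulrAC mulfV ?mul1r// expf_neq0.
Qed.

Lemma arc_length_ge0 g : 0 <= arc_length f g.
Proof. by apply: Rintegral_ge0 => t _; exact: riem_norm_ge0. Qed.

Lemma broken_arc_ge0 x y L : broken_arc f x y L -> 0 <= L.
Proof. by elim=> // g {}y {}L _ _ L0; rewrite addr_ge0// arc_length_ge0. Qed.

Lemma sdist_le x y L : broken_arc f x y L -> sdist f x y <= L.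
Proof.
move=> xyL; apply: ge_inf => //; exists 0 => L'; exact: broken_arc_ge0.
Qed.

(** Paths are built from their far end, following the recursion of [broken_arc].
Only upper bounds of lengths are kept, so that a bound [c] on the speed replaces
the computation of an integral. *)
Lemma broken_arc_polar (rho drho th dth : R -> R) c y L :
  (forall t : R, is_derive t 1 rho (drho t)) -> continuous drho ->
  (forall t : R, is_derive t 1 th (dth t)) -> continuous dth ->
  (forall t, 0 <= t <= 1 -> 0 <= rho t /\
    drho t ^+ 2 + (if rho t == 0 then 0 else f (rho t) * dth t) ^+ 2 <= c ^+ 2) ->
  0 <= c -> broken_arc f (polar (rho 1) (th 1)) y L ->
  exists2 L', broken_arc f (polar (rho 0) (th 0)) y L' & L' <= c + L.
Proof.
move=> rd crd td ctd hc c0 yL.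
have cont (F dF : R -> R) : (forall t : R, is_derive t 1 F (dF t)) -> continuous F.
  move=> Fd t; apply/differentiable_continuous/derivable1_diffP.
  exact: (@ex_derive _ _ _ _ _ _ _ (Fd t)).
have crho := cont _ _ rd; have cth := cont _ _ td.
have ccos : continuous (cos \o th).
  by move=> t; apply: continuous_comp; [exact: cth|exact: continuous_cos].
have csin : continuous (sin \o th).
  by move=> t; apply: continuous_comp; [exact: cth|exact: continuous_sin].
pose g t := polar (rho t) (th t).
have [C1g1 d1] : C1 (fst \o g) /\ derive1 (fst \o g) =
    (fun t => drho t * cos (th t) - rho t * sin (th t) * dth t).
  apply: C1_of_is_derive.
    move=> t.
    have dc := is_derive1_comp (is_derive_cos (th t)) (td t).
    have := is_deriveM (rd t) dc; rewrite /= /GRing.scale/= => h.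
    by apply: is_derive_eq; rewrite /GRing.scale/=; ring.
  move=> t; apply: cvgB.
    by apply: cvgM; [exact: crd|exact: ccos].
  apply: cvgM; last exact: ctd.
  by apply: cvgM; [exact: crho|exact: csin].
have [C1g2 d2] : C1 (snd \o g) /\ derive1 (snd \o g) =
    (fun t => drho t * sin (th t) + rho t * cos (th t) * dth t).
  apply: C1_of_is_derive.
    move=> t.
    have dc := is_derive1_comp (is_derive_sin (th t)) (td t).
    have := is_deriveM (rd t) dc; rewrite /= /GRing.scale/= => h.
    by apply: is_derive_eq; rewrite /GRing.scale/=; ring.
  move=> t; apply: cvgD.
    by apply: cvgM; [exact: crd|exact: csin].
  apply: cvgM; last exact: ctd.
  by apply: cvgM; [exact: crho|exact: ccos].
exists (arc_length f g + L); first exact: (@broken_cons _ _ g).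
rewrite lerD2r /arc_length d1 d2; apply: le_Rintegral01 => t /hc[rho0 rhoc].
rewrite riem_norm_ge0/= riem_norm_polar// -(ger0_norm c0) -sqrtr_sqr.
exact: ler_wsqrtr.
Qed.

Lemma broken_arc_radial r s a y L : 0 <= r -> 0 <= s ->
  broken_arc f (polar s a) y L ->
  exists2 L', broken_arc f (polar r a) y L' & L' <= `|s - r| + L.
Proof.
move=> r0 s0 yL.
have rd t : is_derive t 1 (fun t => r + (s - r) * t) (s - r).
  by apply: is_derive_eq; rewrite /GRing.scale/=; ring.
have := @broken_arc_polar (fun t => r + (s - r) * t) (fun=> s - r) (fun=> a) (fun=> 0)
  `|s - r| y L rd _ _ _ _ (normr_ge0 _).
have -> : r + (s - r) * 1 = s by ring.
have -> : r + (s - r) * 0 = r by ring.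
apply => //.
- exact: cst_continuous.
- exact: cst_continuous.
- move=> t /andP[t0 t1]; split.
    have -> : r + (s - r) * t = r * (1 - t) + s * t by ring.
    by rewrite addr_ge0// mulr_ge0// subr_ge0.
  by case: ifP => _; rewrite ?mulr0 expr0n/= addr0 real_normK// num_real.
Qed.

End PolarArcs.

(** * Distances on the surface of revolution *)

Section SurfaceDistance.
Context {R : realType} (K f : R -> R) (hf : surface_of_revolution K f).
Implicit Types (x y z : R * R) (r a b c t : R).
Notation mu := (@lebesgue_measure R).

(** The quotient f(r) / r tends to 1 at 0, and away from 0 it is controlled by the
maximum of f. *)
Lemma profile_le_linear b : exists c, forall r, 0 < r <= b -> f r <= c * r.
Proof.
have [b0|b0] := leP 0 b; last first.
  by exists 0 => r /andP[r0 rb]; have := lt_trans (lt_le_trans r0 rb) b0; rewrite ltxx.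
have [|s sb sP] := @EVT_max R f 0 b b0.
  apply: continuous_subspaceW (profile_continuous hf) => x /=.
  by rewrite !in_itv/= andbT => /andP[].
have fs0 : 0 <= f s.
  by rewrite -(sor_f0 hf) sP// in_itv/= lexx.
have /cvgrPdist_lt/(_ _ ltr01)[eta /= eta0 etaP] := sor_df0 hf.
exists (2 + f s / eta) => r /andP[r0 rb].
have fseta : 0 <= f s / eta by rewrite divr_ge0// ltW.
have [re|er] := ltP r eta.
  have := etaP r; rewrite /ball/= sub0r normrN gtr0_norm// => /(_ re r0).
  rewrite ltr_norml => /andP[h _].
  have : f r / r < 2 by lra.
  rewrite ltr_pdivrMr// => h2; apply: le_trans (ltW h2) _.
  by rewrite ler_wpM2r ?lerDl// ltW.
apply: (@le_trans _ _ (f s)); first by rewrite sP// in_itv/= rb ltW.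
have : f s <= f s / eta * r.
  by rewrite mulrAC ler_pdivlMr// ler_wpM2l.
by rewrite mulrDl; move=> h; rewrite (le_trans h)// lerDr mulr_ge0// ltW.
Qed.

Lemma rad_ge0 z : 0 <= rad z.
Proof. exact: sqrtr_ge0. Qed.

Lemma sqr_rad z : rad z ^+ 2 = z.1 ^+ 2 + z.2 ^+ 2.
Proof. by rewrite sqr_sqrtr// addr_ge0// sqr_ge0. Qed.

(** The metric differs from the Euclidean one only in the direction orthogonal to
[z], by the factor f(r) / r; the two components of [w] are separated by the
identity of Lagrange. *)
Lemma riem_norm_le c z w : 0 <= c -> (0 < rad z -> f (rad z) <= c * rad z) ->
  riem_norm f z w <= (1 + c) * rad w.
Proof.
move=> c0 hc; rewrite /riem_norm; case: ifPn => [_|z0].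
  by rewrite ler_peMl ?rad_ge0// lerDl.
have rz : 0 < rad z by rewrite lt_def z0 rad_ge0.
have fz : 0 < f (rad z) by exact: (sor_f_gt0 hf).
have c1 : 0 <= (1 + c) * rad w by rewrite mulr_ge0 ?rad_ge0// addr_ge0.
rewrite -(ger0_norm c1) -sqrtr_sqr; apply: ler_wsqrtr.
set p := _ + _ * w.2; set q := _ - _ * w.1.
have pq : p ^+ 2 + q ^+ 2 = rad z ^+ 2 * rad w ^+ 2.
  by rewrite !sqr_rad /p /q; ring.
have h : (f (rad z) * (q / rad z ^+ 2)) ^+ 2 <= c ^+ 2 * (q / rad z) ^+ 2.
  have -> : f (rad z) * (q / rad z ^+ 2) = (f (rad z) / rad z) * (q / rad z) by field.
  have fr : f (rad z) / rad z <= c by rewrite ler_pdivrMr// hc.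
  have fr0 : 0 <= f (rad z) / rad z by rewrite divr_ge0// ltW.
  by rewrite exprMn ler_wpM2r ?sqr_ge0// ler_sqr ?nnegrE.
apply: (@le_trans _ _ ((p / rad z) ^+ 2 + c ^+ 2 * (q / rad z) ^+ 2)).
  by rewrite lerD2l.
have e1 : (p / rad z) ^+ 2 + (q / rad z) ^+ 2 = rad w ^+ 2.
  by rewrite !expr_div_n -mulrDl pq mulrAC mulfV ?mul1r// expf_neq0.
have p0 : 0 <= (p / rad z) ^+ 2 by exact: sqr_ge0.
have q0 : 0 <= (q / rad z) ^+ 2 by exact: sqr_ge0.
rewrite [leRHS]exprMn -e1; have c2 : 0 <= c ^+ 2 by exact: sqr_ge0.
have -> : (1 + c) ^+ 2 = 1 + c *+ 2 + c ^+ 2 by ring.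
move: p0 q0 c2; move: ((p / rad z) ^+ 2) ((q / rad z) ^+ 2) => P Q P0 Q0 c2.
rewrite mulrDr mulr2n.
have : 0 <= c * P by rewrite mulr_ge0.
have : 0 <= c * Q by rewrite mulr_ge0.
have : 0 <= c ^+ 2 * P by rewrite mulr_ge0.
have : c ^+ 2 * P + c ^+ 2 * Q + c * P + c * P + c * Q + c * Q + P + Q =
  (1 + (c + c) + c ^+ 2) * P + (1 + (c + c) + c ^+ 2) * Q by ring.
lra.
Qed.

Lemma radial_le_riem_norm z w : rad z != 0 ->
  `|z.1 * w.1 + z.2 * w.2| / rad z <= riem_norm f z w.
Proof.
move=> z0; rewrite /riem_norm (negbTE z0).
have rz : 0 < rad z by rewrite lt_def z0 rad_ge0.
rewrite -[X in _ / X](gtr0_norm rz) -normfV -normrM -sqrtr_sqr ler_wsqrtr//.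
by rewrite lerDl sqr_ge0.
Qed.

(** The radius decreases or increases at most at unit speed.  As it is not
differentiable at the origin, which the arc may cross, it is replaced by the
function [Num.sqrt (e ^+ 2 + rad z ^+ 2)], which differs from it by at most [e]
and has a smaller slope. *)
Lemma rad_arc_le g : C1_arc g -> rad (g 1) <= rad (g 0) + arc_length f g.
Proof.
move=> [[d1 c1] [d2 c2]].
set g1 := fst \o g in d1 c1 *; set g2 := snd \o g in d2 c2 *.
have D1 t : is_derive t 1 g1 (derive1 g1 t) by rewrite derive1E; exact: derivableP.
have D2 t : is_derive t 1 g2 (derive1 g2 t) by rewrite derive1E; exact: derivableP.
have cg1 : continuous g1.
  by move=> t; apply/differentiable_continuous/derivable1_diffP.
have cg2 : continuous g2.
  by move=> t; apply/differentiable_continuous/derivable1_diffP.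
have crad : continuous (fun t => rad (g t)).
  move=> t; apply: (@continuous_comp _ _ _ (fun t => g1 t ^+ 2 + g2 t ^+ 2) Num.sqrt).
    by apply: cvgD; apply: cvgM; [exact: cg1|exact: cg1|exact: cg2|exact: cg2].
  exact: sqrt_continuous.
have cdg : continuous (fun t => rad (derive1 g1 t, derive1 g2 t)).
  move=> t; apply: (@continuous_comp _ _ _
    (fun t => derive1 g1 t ^+ 2 + derive1 g2 t ^+ 2) Num.sqrt).
    by apply: cvgD; apply: cvgM; [exact: c1|exact: c1|exact: c2|exact: c2].
  exact: sqrt_continuous.
have [b _ bP] := EVT_max ler01 (continuous_subspaceT crad).
have [s _ sP] := EVT_max ler01 (continuous_subspaceT cdg).
have [c' c'P] := profile_le_linear (rad (g b)).
pose c := Num.max 0 c'.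
have c0 : 0 <= c by rewrite le_max lexx.
have cc' : c' <= c by rewrite le_max lexx orbT.
(* a bound on the speed makes the length a finite integral *)
have bound t : 0 <= t <= 1 ->
    0 <= riem_norm f (g t) (derive1 g1 t, derive1 g2 t) <=
    (1 + c) * rad (derive1 g1 s, derive1 g2 s).
  move=> t01; rewrite riem_norm_ge0/=.
  apply: (@le_trans _ _ ((1 + c) * rad (derive1 g1 t, derive1 g2 t))).
    apply: riem_norm_le => // r0; apply: (@le_trans _ _ (c' * rad (g t))).
      by apply: c'P; rewrite r0/=; apply: bP; rewrite in_itv.
    by rewrite ler_wpM2r// ltW.
  by apply: ler_wpM2l; [exact: addr_ge0|apply: sP; rewrite in_itv].
apply/ler_addgt0Pr => e e0.
pose N t := e ^+ 2 + (g1 t ^+ 2 + g2 t ^+ 2).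
have N0 t : 0 < N t by rewrite ltr_pwDl ?exprn_gt0// addr_ge0// sqr_ge0.
have sN0 t : 0 < Num.sqrt (N t) by rewrite sqrtr_gt0.
pose dphi t := (g1 t * derive1 g1 t + g2 t * derive1 g2 t) / Num.sqrt (N t).
have cN : continuous N.
  move=> t; apply: cvgD; first exact: cvg_cst.
  by apply: cvgD; apply: cvgM; [exact: cg1|exact: cg1|exact: cg2|exact: cg2].
have phid t : is_derive t 1 (fun t => Num.sqrt (N t)) (dphi t).
  have dN : is_derive t 1 N ((g1 t * derive1 g1 t + g2 t * derive1 g2 t) *+ 2).
    have h := is_deriveD (is_derive_cst (e ^+ 2) t 1) (is_deriveD
      (is_deriveM (D1 t) (D1 t)) (is_deriveM (D2 t) (D2 t))).
    apply: is_derive_eq h _; rewrite /GRing.scale/= mulr2n; ring.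
  have h := is_derive1_comp (is_derive1_sqrt (N0 t)) dN.
  apply: is_derive_eq h _; rewrite /dphi -mulr_natr.
  by field; rewrite gt_eqF.
have cdphi : continuous dphi.
  move=> t; apply: cvgM.
    by apply: cvgD; apply: cvgM; [exact: cg1|exact: c1|exact: cg2|exact: c2].
  apply: cvgV; first by rewrite gt_eqF.
  by apply: continuous_comp; [exact: cN|exact: sqrt_continuous].
have := FTC_le phid cdphi _ bound.
have le_dphi t : 0 <= t <= 1 ->
    dphi t <= riem_norm f (g t) (derive1 g1 t, derive1 g2 t).
  move=> _; have [z0|z0] := eqVneq (rad (g t)) 0.
    apply: le_trans (riem_norm_ge0 _ _ _).
    have /eqP := sqr_rad (g t); rewrite z0 expr0n/= eq_sym paddr_eq0 ?sqr_ge0//.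
    rewrite !sqrf_eq0 => /andP[/eqP z1 /eqP z2].
    by rewrite /dphi /g1 /g2/= z1 z2 !mul0r addr0 mul0r.
  apply: le_trans (radial_le_riem_norm _ z0); rewrite /dphi/=.
  apply: (@le_trans _ _ (`|g1 t * derive1 g1 t + g2 t * derive1 g2 t| / Num.sqrt (N t))).
    by rewrite ler_wpM2r ?invr_ge0 ?ler_norm// ltW.
  apply: ler_wpM2l => //; rewrite lef_pV2 ?posrE//; last by rewrite lt_def z0 rad_ge0.
  by apply: ler_wsqrtr; rewrite lerDr sqr_ge0.
move=> /(_ le_dphi); rewrite -/(arc_length f g).
have l1 : rad (g 1) <= Num.sqrt (N 1) by apply: ler_wsqrtr; rewrite lerDr sqr_ge0.
have l0 : Num.sqrt (N 0) <= rad (g 0) + e.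
  have re : 0 <= rad (g 0) + e by rewrite addr_ge0 ?rad_ge0// ltW.
  rewrite -(ger0_norm re) -sqrtr_sqr; apply: ler_wsqrtr.
  have ree : 0 <= rad (g 0) * e by rewrite mulr_ge0 ?rad_ge0// ltW.
  by rewrite sqrrD sqr_rad /N /g1 /g2/= mulr2n; lra.
lra.
Qed.

Lemma rad_broken_arc_le x y L : broken_arc f x y L -> rad y <= rad x + L.
Proof.
elim=> [z|g z {}L gC _ IH]; first by rewrite addr0.
by apply: le_trans IH _; rewrite addrA lerD2r; exact: rad_arc_le.
Qed.

(** Meridians are shortest: [rad_broken_arc_le] bounds all other arcs. *)
Lemma sdist_origin r a : 0 <= r -> sdist f origin (polar r a) = r.
Proof.
move=> r0; have o0 : origin = polar 0 a :> R * R by rewrite /origin /polar !mul0r.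
have [L oL] := @broken_arc_radial _ f 0 r a _ 0 (lexx 0) r0 (broken_nil _ _).
rewrite subr0 addr0 ger0_norm// -o0 in oL * => Lr.
apply/eqP; rewrite eq_le (le_trans (sdist_le oL))//=.
apply: lb_le_inf; first by exists L.
move=> L' /rad_broken_arc_le; rewrite rad_polar ger0_norm// o0 rad_polar normr0.
by rewrite add0r.
Qed.

(** In the development of the cone of slope [k], where the angle is multiplied by
[k], the two end points are at Cartesian coordinates [(h, - w)] and [(h, w)].
The straight segment between them, traversed at constant speed [2 * w], is the
curve (h, v t), whose polar coordinates are [sqrt (h ^+ 2 + v t ^+ 2)] and, back
on the surface, [atan (v t / h) / k].  Since [h >= N] the segment stays where
f(s) <= k s, so its length on the surface is at most [2 * w]. *)
Lemma broken_arc_chord (k N : R) r a b y L : 0 < k < 1 ->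
  (forall s, N <= s -> f s <= k * s) -> 0 < N -> 0 < r ->
  a <= b <= a + pi ->
  N <= r * cos (k * ((b - a) / 2)) -> broken_arc f (polar r b) y L ->
  exists2 L', broken_arc f (polar r a) y L' &
    L' <= 2 * r * sin (k * ((b - a) / 2)) + L.
Proof.
move=> /andP[k0 k1] fk N0 r0 /andP[ab ba] Nc yL.
set B := k * ((b - a) / 2) in Nc *.
have p0 := @pi_gt0 R.
have B0 : 0 <= B by apply: mulr_ge0; [exact: ltW|rewrite divr_ge0// subr_ge0].
have Bp : B < pi / 2.
  apply: (@le_lt_trans _ _ (k * (pi / 2))).
    by apply: ler_wpM2l; [exact: ltW|rewrite ler_wpM2r// lerBlDl].
  by rewrite gtr_pMl// divr_gt0.
have BpN : - (pi / 2) < B by rewrite (lt_le_trans _ B0)// oppr_lt0 divr_gt0.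
set h := r * cos B in Nc; pose w := r * sin B.
have h0 : 0 < h by exact: lt_le_trans Nc.
have w0 : 0 <= w by apply: mulr_ge0; [exact: ltW|apply: sin_ge0_pi; rewrite B0/=; lra].
have hw : h ^+ 2 + w ^+ 2 = r ^+ 2 by rewrite !exprMn -mulrDr cos2Dsin2 mulr1.
have wh : atan (w / h) = B.
  have -> : w / h = tan B by rewrite /tan /w /h -mulf_div divff ?mul1r// gt_eqF.
  by apply: tanK; rewrite in_itv/= BpN Bp.
pose v t : R := w * (2 * t - 1).
pose S t := h ^+ 2 + v t ^+ 2.
pose m := (a + b) / 2.
have dv t : is_derive t 1 v (2 * w).
  by apply: is_derive_eq; rewrite /GRing.scale/=; ring.
have cv : continuous v.
  move=> t; apply/differentiable_continuous/derivable1_diffP.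
  exact: (@ex_derive _ _ _ _ _ _ _ (dv t)).
have S0 t : 0 < S t by rewrite ltr_pwDl ?exprn_gt0// sqr_ge0.
have sS0 t : 0 < Num.sqrt (S t) by rewrite sqrtr_gt0.
have dS t : is_derive t 1 S (v t * (2 * w) *+ 2).
  have H := is_deriveD (is_derive_cst (h ^+ 2) t 1) (is_deriveM (dv t) (dv t)).
  by apply: is_derive_eq H _; rewrite /GRing.scale/= mulr2n; ring.
have cS : continuous S.
  move=> t; apply: cvgD; first exact: cvg_cst.
  by apply: cvgM; exact: cv.
pose rho t := Num.sqrt (S t).
pose drho t := v t * (2 * w) / rho t.
have drhoE t : is_derive t 1 rho (drho t).
  have H := is_derive1_comp (is_derive1_sqrt (S0 t)) (dS t).
  apply: is_derive_eq H _; rewrite /drho /rho -mulr_natr.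
  by field; rewrite gt_eqF.
have crho : continuous rho.
  by move=> t; apply: continuous_comp; [exact: cS|exact: sqrt_continuous].
pose th t := m + k^-1 * atan (v t / h).
pose dth t := k^-1 * (2 * w * h / S t).
have dthE t : is_derive t 1 th (dth t).
  have H1 := is_deriveM (dv t) (is_derive_cst h^-1 t 1).
  have H2 := @is_derive1_comp _ atan (v * cst h^-1) t _ _ (is_derive1_atan _) H1.
  have H3 := is_deriveD (is_derive_cst m t 1)
     (is_deriveM (is_derive_cst k^-1 t 1) H2).
  apply: is_derive_eq H3 _; rewrite /GRing.scale/= /dth /S.
  have hS : h ^+ 2 + v t ^+ 2 != 0 by rewrite gt_eqF// S0.
  rewrite !mulr0 ?add0r ?addr0 -[(v * cst h^-1) t]/(v t / h).
  field.
  by rewrite (gt_eqF h0) (gt_eqF k0) hS.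
have r1 : rho 1 = r.
  by rewrite /rho /S /v mulr1 (_ : 2 - 1 = 1 :> R) ?mulr1 ?hw ?sqrtr_sqr ?gtr0_norm//; ring.
have r0' : rho 0 = r.
  by rewrite /rho /S /v mulr0 sub0r mulrN1 sqrrN hw sqrtr_sqr gtr0_norm.
have kB : k^-1 * B = (b - a) / 2 by rewrite /B mulKf// gt_eqF.
have th1 : th 1 = b.
  rewrite /th /v mulr1 (_ : 2 - 1 = 1 :> R); last by ring.
  by rewrite mulr1 wh kB /m; field.
have th0 : th 0 = a.
  by rewrite /th /v mulr0 sub0r mulrN1 mulNr atanN mulrN wh kB /m; field.
have := @broken_arc_polar _ f rho drho th dth (2 * w) y L drhoE _ dthE _ _ _.
rewrite r1 r0' th1 th0 mulrA; apply => //.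
- move=> t; apply: cvgM; first by apply: cvgM; [exact: cv|exact: cvg_cst].
  by apply: cvgV; [rewrite gt_eqF//; exact: sS0|exact: crho].
- move=> t; apply: cvgM; first exact: cvg_cst.
  apply: cvgM; first exact: cvg_cst.
  by apply: cvgV; [rewrite gt_eqF|exact: cS].
- move=> t _; split; first exact: sqrtr_ge0.
  rewrite gt_eqF; last exact: sS0.
  have Nrho : N <= rho t.
    apply: le_trans Nc _; rewrite -(gtr0_norm h0) -sqrtr_sqr; apply: ler_wsqrtr.
    by rewrite lerDl sqr_ge0.
  have f0 : 0 < f (rho t) by apply: (sor_f_gt0 hf); exact: sS0.
  have fle := fk _ Nrho.
  have Sr : rho t ^+ 2 = S t by rewrite sqr_sqrtr// ltW.
  have f2 : f (rho t) ^+ 2 <= k ^+ 2 * S t.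
    rewrite -Sr -exprMn ler_sqr ?nnegrE//; first exact: ltW.
    exact: le_trans (ltW f0) fle.
  rewrite exprMn [X in _ + X](_ : _ = f (rho t) ^+ 2 * dth t ^+ 2) ?exprMn//.
  have : f (rho t) ^+ 2 * dth t ^+ 2 <= k ^+ 2 * S t * dth t ^+ 2.
    by rewrite ler_wpM2r// sqr_ge0.
  have -> : k ^+ 2 * S t * dth t ^+ 2 = (2 * w) ^+ 2 * (h ^+ 2 / S t).
    rewrite /dth; field; by rewrite gt_eqF//= gt_eqF.
  have : drho t ^+ 2 = (2 * w) ^+ 2 * (v t ^+ 2 / S t).
    by rewrite /drho expr_div_n Sr exprMn; field; rewrite gt_eqF.
  have : (2 * w) ^+ 2 * (v t ^+ 2 / S t) + (2 * w) ^+ 2 * (h ^+ 2 / S t) = (2 * w) ^+ 2.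
    rewrite -mulrDr -mulrDl [v t ^+ 2 + _]addrC divff ?mulr1//.
    by rewrite gt_eqF// S0.
  rewrite !exprMn; lra.
- by rewrite -mulrA mulr_ge0.
Qed.


(** Going along meridians to and from the circle of radius [r], and along the chord
in between, saves [2 * r * (1 - sin B)] with [B <= k * (pi / 2) < pi / 2].  This
exceeds [2 * rho] for large [r]. *)
Lemma sdist_detour : (0 < total_curvature K f)%E -> forall rho, exists2 r, 0 < r &
  forall r1 r2 a b, r <= r1 -> r <= r2 -> a <= b <= a + pi ->
  sdist f (polar r1 a) (polar r2 b) < r1 + r2 - 2 * rho.
Proof.
move=> /(profile_growth hf)[k /andP[k0 k1] [N N0 fk]] rho.
have p0 := @pi_gt0 R.
have kp0 : 0 < k * (pi / 2) by rewrite mulr_gt0// divr_gt0.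
have kp : k * (pi / 2) < pi / 2 by rewrite gtr_pMl// divr_gt0.
set B0 := k * (pi / 2) in kp0 kp.
have c0 : 0 < cos B0 by apply: cos_gt0_pihalf; apply/andP; split; lra.
have s1 : sin B0 < 1.
  rewrite -sin_pihalf ltr_sin// in_itv/=; apply/andP; split; lra.
have s1' : 0 < 1 - sin B0 by rewrite subr_gt0.
pose q := Num.max 0 rho + 1.
have q0 : 0 < q by rewrite ltr_wpDl// le_max lexx.
have qrho : rho < q by rewrite ltr_pwDr// le_max lexx orbT.
pose r := N / cos B0 + q / (1 - sin B0).
have r0 : 0 < r by rewrite addr_gt0// divr_gt0.
have rN : N <= r * cos B0.
  by rewrite -ler_pdivrMr// lerDl divr_ge0// ltW.
have rq : q <= r * (1 - sin B0).
  by rewrite -ler_pdivrMr// lerDr divr_ge0// ltW.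
exists r => // r1 r2 a b rr1 rr2 /andP[ab ba].
have r10 : 0 < r1 by exact: lt_le_trans rr1.
have r20 : 0 < r2 by exact: lt_le_trans rr2.
set B := k * ((b - a) / 2).
have B_ge0 : 0 <= B by apply: mulr_ge0; [exact: ltW|rewrite divr_ge0// subr_ge0].
have BB0 : B <= B0.
  by apply: ler_wpM2l; [exact: ltW|rewrite ler_wpM2r// lerBlDl].
have cosB : cos B0 <= cos B.
  by rewrite leNgt ltr_cos ?in_itv/= -?leNgt//; apply/andP; split; lra.
have sinB : sin B <= sin B0.
  by rewrite leNgt ltr_sin ?in_itv/= -?leNgt//; apply/andP; split; lra.
have [L1 l1 L1P] := broken_arc_radial (ltW r0) (ltW r20) (broken_nil f (polar r2 b)).
have k01 : 0 < k < 1 by rewrite k0.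
have abp : a <= b <= a + pi by rewrite ab.
have [|L2 l2 L2P] := broken_arc_chord k01 fk N0 r0 abp _ l1.
  by apply: le_trans rN _; rewrite ler_wpM2l// ltW.
have [L3 l3 L3P] := broken_arc_radial (ltW r10) (ltW r0) l2.
apply: le_lt_trans (sdist_le l3) _.
rewrite -/B in L2P.
have e1 : `|r - r1| = r1 - r by rewrite ler0_norm ?opprB// subr_le0.
have e2 : `|r2 - r| = r2 - r by rewrite ger0_norm// subr_ge0.
rewrite e1 in L3P; rewrite e2 in L1P.
have : 2 * r * sin B <= 2 * r * sin B0 by rewrite ler_wpM2l// mulr_ge0// ltW.
have : r * (1 - sin B0) = r - r * sin B0 by ring.
have : 2 * r * sin B0 = 2 * (r * sin B0) by ring.
lra.
Qed.

End SurfaceDistance.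

(** * Comparison with the surface *)

(** The comparison triangle of [o], [p], [q] has the same side lengths, so it is
enough to estimate the distance of its vertices on the surface; these have polar
radii [d o p] and [d o q], and angles that differ by at most pi. *)
Lemma radial_bound_short_chords (R : realType) (K f : R -> R) (M : metricType R) (o : M) :
  surface_of_revolution K f -> (0 < total_curvature K f)%E ->
  radial_curvature_bounded_below f o -> short_chords o.
Proof.
move=> hf tot [[cM kM lM _] comp _] rho.
have [r r0 rP] := sdist_detour hf tot rho; exists r => p q rp rq.
have po : p <> o by move=> po; move: rp; rewrite po mdistxx leNgt r0.
have qo : q <> o by move=> qo; move: rq; rewrite qo mdistxx leNgt r0.
have [Top opT] := segment_exists o p cM kM lM.
have [Toq oqT] := segment_exists o q cM kM lM.
have [Tpq pqT] := segment_exists p q cM kM lM.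
have [|qt [_ [_ [_ [[[a [b [pta qtb ab]]] _] _ [_ dq dpq] _]]]]] :=
  comp p q Top Toq Tpq po qo; first by split.
rewrite -dpq qtb pta; have dp0 := mdist_ge0 o p.
have -> : rad (base_reference o p) = mdist o p by rewrite rad_polar ger0_norm.
have rq' : rad qt = mdist o q.
  by rewrite -dq {2}qtb (sdist_origin hf)// rad_ge0.
by rewrite rq'; apply: rP.
Qed.

Theorem corollary4 (R : realType) (K f : R -> R)
    (hMt : surface_of_revolution K f)
    (M : metricType R) (o : M)
    (hM : radial_curvature_bounded_below f o)
    (hnoncompact : ~ compact [set: M])
    (hpos : (0 < total_curvature K f)%E) :
  has_one_end M /\ ~ (exists g : R -> M, straight_line (@mdist R M) g).
Proof.
have short := radial_bound_short_chords hMt hpos hM.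
have [[cM kM lM _] _ _] := hM.
split; last exact: no_straight_line short.
apply: (one_end (o := o)) => // [r|x y]; first exact: compact_mball.
exact: segment_exists.
Qed.
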